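(* Consider the two-player volunteer's dilemma with benefit $B\in(1,2)$ and uniformly distributed private costs $x\in\mathcal X=[0,1]$ described in the context. Let $\tilde S$ be the set of indifferent types of sym-QRE, i.e. the set of all $\tilde x(\sigma)$ with $\sigma\in\Sigma$ a sym-QRE, where $\tilde x(\sigma)$ is the type with $\Delta\bar u_{\tilde x(\sigma)}(\sigma)=0$. Then $\tilde S=\left(\frac{B}{B+1},\frac{B}{2}\right)$, and a strategy $\sigma\in\Sigma$ is a sym-QRE if and only if: (i) $\sigma$ is continuous and strictly increasing; (ii) $\sigma(x)\in(0,1)$ for all $x\in\mathcal X$; (iii) there exists a unique indifferent type $\tilde x\in\tilde S=\left(\frac{B}{B+1},\frac{B}{2}\right)$ such that $\sigma(\tilde x)=\frac12$ and $\tilde x=B\int_0^1\sigma(x')\,dx'$; (iv) $\sigma$ is symmetric, satisfying $\sigma(\tilde x+\delta)=1-\sigma(\tilde x-\delta)$ for any $\delta\in[0,1-\tilde x]$.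
   Context: Volunteer's dilemma. Two players simultaneously choose to volunteer (action 0) or abstain (action 1). If at least one volunteers, both receive $B$; a volunteer pays their private cost $x$, with $x$ uniform on $[0,1]$, i.i.d. across players. $\Sigma$ is the set of Lebesgue measurable $\sigma:[0,1]\to[0,1]$, where $\sigma(x)$ is the probability that a player with cost $x$ abstains; both players use the same $\sigma$. The expected payoffs of type $x$ are $\bar u^0_x(\sigma)=B-x$ (volunteer) and $\bar u^1_x(\sigma)=B\int_0^1(1-\sigma(x'))\,dx'$ (abstain); write $\bar u_x(\sigma)=(\bar u^1_x(\sigma),\bar u^0_x(\sigma))$ and $\Delta\bar u_x(\sigma)=\bar u^1_x(\sigma)-\bar u^0_x(\sigma)=x-B\int_0^1\sigma(x')\,dx'$. Symmetry. $\sigma\in\Sigma$ is symmetric if for all $x,x'\in[0,1]$: $\sigma(x)=1-\sigma(x')\iff\Delta\bar u_x(\sigma)=-\Delta\bar u_{x'}(\sigma)$. Sym-QRE. $\sigma\in\Sigma$ is a sym-QRE if there exists $Q:\mathbb R^2\to[0,1]$ with $\sigma(x)=Q(\bar u_x(\sigma))$ for all $x\in[0,1]$ satisfying, with $v=(v^1,v^0)$: (R1) $Q(v)\in(0,1)$ for all $v$; (R2) $Q$ is continuous; (R3) $\frac{\partial Q(v)}{\partial v^1}>0>\frac{\partial Q(v)}{\partial v^0}$ for all $v\in\mathbb R^2$; (R4) $v^1>v^0\iff Q(v)>1-Q(v)$; (S1) $Q(v+\gamma(1,1))=Q(v)$ for all $v\in\mathbb R^2,\gamma\in\mathbb R$;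 (S2) $Q(v^1,v^0)=1-Q(v^0,v^1)$ for all $(v^1,v^0)\in\mathbb R^2$.
   Formalization: The characterization also requires σ to be differentiable on [0,1] (one-sided at 0 and 1) with positive derivative; (R3) forces this, and (i)–(iv) alone do not imply it (a strictly increasing σ with a kink can satisfy them), so the stated ''if'' is false. *)

(* Defs.v *)
From HB Require Import structures.
From mathcomp Require Import all_boot all_order all_algebra.
From mathcomp Require Import all_classical all_reals all_analysis.
Import Order.TTheory GRing.Theory Num.Theory.
Import numFieldNormedType.Exports.

Set Implicit Arguments.
Unset Strict Implicit.
Unset Printing Implicit Defensive.

Local Open Scope classical_set_scope.
Local Open Scope ring_scope.

(* The library's default sigma-algebra on R is the Borel one. The real line
   with the Lebesgue sigma-algebra is the Caratheodory type on which
   [completed_lebesgue_measure] is defined. *)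
Definition lebesgueType (R : realType) :=
  caratheodory_type (@wlength R idfun)^*%mu.

(* Strategies are functions [0, 1] -> [0, 1], encoded as functions on R of
   which only the values on [0, 1] are ever used. *)
Definition strategy (R : realType) (sigma : R -> R) : Prop :=
  measurable_fun (`[0, 1] : set (lebesgueType R))
                 (sigma : lebesgueType R -> measurableTypeR R) /\
  {in `[0, 1], forall x : R, 0 <= sigma x <= 1}.

Definition integral01 (R : realType) (f : R -> R) : R :=
  \int[@completed_lebesgue_measure R]_(x in `[0, 1]) f x.

Definition payoff_abstain (R : realType) (B : R) (sigma : R -> R) (x : R) : R :=
  B * integral01 (fun x' => 1 - sigma x').

Definition payoff_volunteer (R : realType) (B : R) (sigma : R -> R) (x : R)
  : R := B - x.

(* Payoff vectors are ordered as v = (v^1, v^0): abstain, volunteer. *)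
Definition payoff (R : realType) (B : R) (sigma : R -> R) (x : R) : R * R :=
  (payoff_abstain B sigma x, payoff_volunteer B sigma x).

Definition payoff_diff (R : realType) (B : R) (sigma : R -> R) (x : R) : R :=
  payoff_abstain B sigma x - payoff_volunteer B sigma x.

Definition symmetric_strategy (R : realType) (B : R) (sigma : R -> R) : Prop :=
  {in `[0, 1] &, forall x x' : R,
    sigma x = 1 - sigma x' <->
    payoff_diff B sigma x = - payoff_diff B sigma x'}.

Record sym_quantal_response (R : realType) (Q : R * R -> R) : Prop := {
  qr_interior : forall v : R * R, 0 < Q v < 1;
  qr_continuous : continuous Q;
  (* The derivative operator is total, so that existence of the partial
     derivatives has to be required separately. *)
  qr_responsive1 : forall v : R * R,
    derivable (fun t : R => Q (t, v.2)) v.1 1 /\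
    0 < derive1 (fun t : R => Q (t, v.2)) v.1;
  qr_responsive0 : forall v : R * R,
    derivable (fun t : R => Q (v.1, t)) v.2 1 /\
    derive1 (fun t : R => Q (v.1, t)) v.2 < 0;
  qr_monotone : forall v, v.2 < v.1 <-> 1 - Q v < Q v;
  qr_translation : forall v gamma, Q (v.1 + gamma, v.2 + gamma) = Q v;
  qr_label : forall v1 v0, Q (v1, v0) = 1 - Q (v0, v1)
}.

Definition sym_QRE (R : realType) (B : R) (sigma : R -> R) : Prop :=
  strategy sigma /\
  exists Q : R * R -> R, sym_quantal_response Q /\
    {in `[0, 1], forall x : R, sigma x = Q (payoff B sigma x)}.

Definition indifferent_types (R : realType) (B : R) : set R :=
  [set x : R | x \in `[0, 1] /\
           exists sigma, sym_QRE B sigma /\ payoff_diff B sigma x = 0].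

(* Differentiability on [0, 1], one-sided at 0 and 1, with a derivative that is
   finite and positive everywhere. If sigma x = Q (payoff B sigma x) on [0, 1],
   then Q (sigma's constant abstention payoff, B - x) = sigma x, so this is what
   the strict signs of the partial derivatives of Q say about sigma; it does not
   follow from sigma being continuous and strictly increasing. *)
Definition pos_derivable01 (R : realType) (sigma : R -> R) : Prop :=
  {in `[0, 1], forall x : R, exists2 c : R, 0 < c &
    (sigma y - sigma x) / (y - x) @[y --> within `[0, 1] x^'] --> c}.

(* Main.v *)
(* A quantal response depends only on the payoff difference, so a sym-QRE is a
   strategy [sigma x = g (x - a)] with [a = B * integral01 sigma], where [g] takes
   values in (0, 1), has a positive derivative, and satisfies [g (- t) = 1 - g t].
   The last identity makes the integral of [g] over an interval centred at 0 half
   its length. Hence for [1 / 2 < a < 1] the integral of [sigma] lies strictly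
   between [1 - a] and [1 / 2], which is [B / (B + 1) < a < B / 2]; the other
   positions of [a] contradict [1 < B < 2]. Every such [a] is attained by
   [g t = 1 / 2 + t / (2 * sqrt (t ^+ 2 + s))] for a suitable [s]. Conversely, a
   strategy satisfying (i)-(iv) gives the values of [g] on [[- a, 0]]; they are
   extended to the left by a hyperbola and to the right by symmetry. *)
Require Import Defs.
From mathcomp Require Import all_boot all_order all_algebra.
From mathcomp Require Import all_classical all_reals all_analysis.
From mathcomp Require Import measurable_realfun.
From mathcomp Require Import ring lra.
Import Order.TTheory GRing.Theory Num.Theory.
Import numFieldNormedType.Exports.

Local Open Scope classical_set_scope.
Local Open Scope ring_scope.

(** * Strategies and the integral on the Lebesgue sigma-algebra *)

Lemma measurable_id_lebesgueType (R : realType) :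
  measurable_fun [set: lebesgueType R] (id : lebesgueType R -> measurableTypeR R).
Proof. by move=> _ A mA; rewrite setTI; exact: sub_caratheodory. Qed.

Lemma measurable_itv_lebesgueType (R : realType) (i : interval R) :
  measurable ([set` i] : set (lebesgueType R)).
Proof. by apply: sub_caratheodory; exact: measurable_itv. Qed.

Lemma continuous_strategy {R : realType} {f : R -> R} :
  continuous f -> (forall x, 0 <= f x <= 1) -> strategy f.
Proof.
move=> cf f01; split=> [|x _]; last exact: f01.
apply: (@measurableT_comp _ _ _ _ _ _ f); first exact: continuous_measurable_fun.
by apply: measurable_funS (measurable_id_lebesgueType R).
Qed.

Lemma strategy_integrable {R : realType} {f : R -> R} : strategy f ->
  (@completed_lebesgue_measure R).-integrable `[0, 1] (EFin \o f).
Proof.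
move=> [mf f01]; apply: measurable_bounded_integrable.
- exact: measurable_itv_lebesgueType.
(* On this set the completed measure and [lebesgue_measure] have convertible values. *)
- change (lebesgue_measure (`[0%R, 1%R] : set (measurableTypeR R)) < +oo)%E.
  by rewrite lebesgue_measure_itv/= lte_fin ltr01 -EFinB ltry.
- exact: mf.
- exists 1; split=> // M /ltW M1 x /= x01.
  by have /andP[f0 f1] := f01 x x01; rewrite ger0_norm// (le_trans f1).
Qed.

Lemma integral01_cst (R : realType) (c : R) : integral01 (fun=> c) = c.
Proof.
rewrite /integral01 Rintegral_cst; last exact: measurable_itv_lebesgueType.
change (c * fine (lebesgue_measure (`[0%R, 1%R] : set (measurableTypeR R))) = c).
by rewrite lebesgue_measure_itv/= lte_fin ltr01 -EFinB/= subr0 mulr1.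
Qed.

Lemma payoff_abstainE {R : realType} (B : R) {sigma : R -> R} (x : R) :
  strategy sigma -> payoff_abstain B sigma x = B - B * integral01 sigma.
Proof.
move=> ssigma; rewrite /payoff_abstain {1}/integral01 RintegralB.
- by rewrite -/(integral01 sigma) -/(integral01 (fun=> 1)) integral01_cst mulrBr mulr1.
- exact: measurable_itv_lebesgueType.
- apply: strategy_integrable; apply: continuous_strategy => [|_].
    exact: cst_continuous.
  by rewrite ler01 lexx.
- exact: strategy_integrable.
Qed.

Lemma payoff_diffE {R : realType} (B : R) {sigma : R -> R} (x : R) :
  strategy sigma -> payoff_diff B sigma x = x - B * integral01 sigma.
Proof.
by move=> ?; rewrite /payoff_diff payoff_abstainE// /payoff_volunteer; ring.
Qed.

Lemma eq_integral01 {R : realType} {f g : R -> R} :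
  {in `[0, 1], f =1 g} -> integral01 f = integral01 g.
Proof. by move=> fg; apply: eq_Rintegral => x /set_mem x01; exact: fg. Qed.

(** The identity from the Lebesgue to the Borel sigma-algebra is measurable and pushes the completed
    measure forward to [lebesgue_measure]. Integration against a pushforward then gives access to
    the fundamental theorem of calculus. *)
Lemma integral01_lebesgue {R : realType} {f : R -> R} :
  continuous f -> (forall x, 0 <= f x <= 1) ->
  integral01 f = \int[lebesgue_measure]_(x in `[0, 1]) f x.
Proof.
move=> cf f01; congr fine.
pose f' := f : measurableTypeR R -> R.
have mf : measurable_fun [set: measurableTypeR R] (EFin \o f').
  by apply/measurable_EFinP; exact: continuous_measurable_fun.
pose phi : lebesgueType R -> measurableTypeR R := id.
have mphi : measurable_fun [set: lebesgueType R] phi.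
  exact: measurable_id_lebesgueType.
have /(_ (measurable_itv _)) := @integral_pushforward _ _ _ _ R phi mphi
  (@completed_lebesgue_measure R) [set` `[0%R, 1%R]] _ mf
  (strategy_integrable (continuous_strategy cf f01)).
move=> <-.
by apply: eq_measure_integral => A _ _; reflexivity.
Qed.

Lemma integral01_FTC {R : realType} {f F : R -> R} :
  continuous f -> (forall x, 0 <= f x <= 1) ->
  (forall x : R, 0 <= x <= 1 -> is_derive x 1 F (f x)) ->
  integral01 f = F 1 - F 0.
Proof.
move=> cf f01 dF; rewrite integral01_lebesgue// /Rintegral.
have cF (x : R) : 0 <= x <= 1 -> {for x, continuous F}.
  move=> /dF [dFx _].
  by apply: differentiable_continuous; exact/derivable1_diffP.
rewrite (@continuous_FTC2 _ f F)//.
- exact: continuous_subspaceT.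
- split=> [x|/=|/=].
  + by rewrite in_itv/= => /andP[/ltW x0 /ltW x1]; case: (dF x); rewrite ?x0.
  + by apply: cvg_at_right_filter; apply: cF; rewrite lexx ler01.
  + by apply: cvg_at_left_filter; apply: cF; rewrite lexx ler01.
- move=> x; rewrite in_itv/= => /andP[/ltW x0 /ltW x1].
  by rewrite derive1E; case: (dF x); rewrite ?x0.
Qed.

(** * Derivatives as limits of difference quotients *)

Lemma is_derive_quotient {R : realType} {f : R -> R} {x c : R} :
  is_derive x 1 f c <-> (f y - f x) / (y - x) @[y --> x^'] --> c.
Proof.
have quotE : (fun h : R => h^-1 *: ((f \o shift x) (h *: 1) - f x)) =
    (fun y => (f y - f x) / (y - x)) \o shift x.
  by apply/funext => h /=; rewrite addrK [h *: _]mulr1 mulrC.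
have shiftE : shift x @ (0 : R)^' = x^'.
  apply/seteqP; split=> A /nbhs_ballP[e e0 eA]; apply/nbhs_ballP;
    exists e => // y yx.
  - move=> yNx; have := eA (y - x); rewrite /= subrK subr_eq0; apply=> //.
    by move: yx; rewrite /ball/= sub0r normrN distrC.
  - move=> yN0; apply: eA; last by rewrite /= -subr_eq0 addrK.
    by move: yx; rewrite /ball/= sub0r opprD addrCA subrr addr0.
have cvgE (l : R) : (h^-1 *: ((f \o shift x) (h *: 1) - f x) @[h --> (0 : R)^'] --> l)
    = ((f y - f x) / (y - x) @[y --> x^'] --> l).
  by rewrite quotE -[in RHS]shiftE.
split=> [[dfx <-]|fxc]; first by rewrite -cvgE.
have fxc' : h^-1 *: ((f \o shift x) (h *: 1) - f x) @[h --> (0 : R)^'] --> c.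
  by rewrite cvgE.
apply: DeriveDef; first by apply/cvg_ex; exists c.
exact: cvg_lim fxc'.
Qed.

Lemma is_derive_continuous {R : realType} {f : R -> R} {x c : R} :
  is_derive x 1 f c -> {for x, continuous f}.
Proof.
by move=> [dfx _]; apply: differentiable_continuous; exact/derivable1_diffP.
Qed.

Lemma is_derive_translate {R : realType} {f : R -> R} (a : R) {x c : R} :
  is_derive (x + a) 1 f c -> is_derive x 1 (fun y => f (y + a)) c.
Proof.
move=> df; have : is_derive x 1 (f \o shift a) (c * (1 + 0)).
  by apply: is_derive1_comp.
by rewrite addr0 mulr1.
Qed.

Lemma is_derive_reflect {R : realType} {f : R -> R} (a : R) {x c : R} :
  is_derive (a - x) 1 f c -> is_derive x 1 (fun y => f (a - y)) (- c).
Proof.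
move=> df; have : is_derive x 1 (f \o (fun y => a - y)) (c * (0 - 1)).
  by apply: is_derive1_comp.
by rewrite sub0r mulrN1.
Qed.

(** * Link functions and quantal responses *)

(** This is a symmetric quantal response seen as a function of [v.1 - v.2]. Continuity follows from
    differentiability, and (R4) from monotonicity together with [g 0 = 1 / 2]. *)
Record link_function {R : realType} (g : R -> R) : Prop := {
  link_itv : forall t, 0 < g t < 1;
  link_derive : forall t : R, exists2 c, 0 < c & is_derive t 1 g c;
  linkN : forall t, g (- t) = 1 - g t }.
Arguments link_itv {R g}.
Arguments link_derive {R g}.
Arguments linkN {R g}.

Section link_function.
Context {R : realType} {g : R -> R} (lg : link_function g).

Lemma link_continuous : continuous g.
Proof. by move=> t; have [c _ /is_derive_continuous] := link_derive lg t. Qed.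

Lemma link_continuous_shift (a : R) : continuous (fun t => g (t - a)).
Proof.
move=> t; have [c _ /is_derive_translate] := link_derive lg (t - a).
exact: is_derive_continuous.
Qed.

Lemma link0 : g 0 = 1 / 2.
Proof. by have := linkN lg 0; rewrite oppr0 => g0; lra. Qed.

Lemma link_homo : {homo g : x y / x < y}.
Proof.
move=> x y xy.
have [z _ gE] : exists2 z : R, z \in `]x, y[ & g y - g x = derive1 g z * (y - x).
  apply: MVT => // [z _|]; last by apply: continuous_subspaceT link_continuous.
  by have [c _ [dg _]] := link_derive lg z; rewrite derive1E; exact: derivableP.
rewrite -subr_gt0 gE mulr_gt0 ?subr_gt0//.
by have [c c0 [_ gc]] := link_derive lg z; rewrite derive1E gc.
Qed.

Lemma link_mono : {mono g : x y / x < y}.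
Proof. exact: leW_mono (le_mono link_homo). Qed.

Lemma link_quantal_response : sym_quantal_response (fun v => g (v.1 - v.2)).
Proof.
split=> [v|v|v|v|v|v t|a b].
- exact: link_itv.
- apply: (@continuous_comp _ _ _ (fun v : R * R => v.1 - v.2) g).
    by apply: continuousB; [exact: cvg_fst|exact: cvg_snd].
  exact: link_continuous.
- have [c c0 /is_derive_translate[dg gc]] := link_derive lg (v.1 - v.2).
  by split; [exact: dg|rewrite derive1E gc].
- have [c c0 /is_derive_reflect[dg gc]] := link_derive lg (v.1 - v.2).
  by split; [exact: dg|rewrite derive1E gc oppr_lt0].
- rewrite -subr_gt0 -(link_mono 0) link0; split=> h; lra.
- by rewrite /= opprD addrACA subrr addr0.
- by rewrite /= -linkN ?opprB.
Qed.

End link_function.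

Lemma quantal_response_link {R : realType} {Q : R * R -> R} :
  sym_quantal_response Q ->
  link_function (fun t => Q (t, 0)) /\ forall v, Q v = Q (v.1 - v.2, 0).
Proof.
move=> sQ; have QB v : Q v = Q (v.1 - v.2, 0).
  (* Translation by [- v.2] normalises the payoff of volunteering to [0]. *)
  by rewrite -[LHS](qr_translation sQ v (- v.2)) subrr.
split=> //; split=> t.
- exact: qr_interior.
- have [dQ Q0] := qr_responsive1 sQ (t, 0).
  exists (derive1 (fun t => Q (t, 0)) t) => //.
  by rewrite derive1E; exact: derivableP.
- by rewrite QB/= -(qr_label sQ 0 t) [in RHS]QB/= sub0r subr0.
Qed.

Lemma sym_QRE_link {R : realType} (B : R) (sigma : R -> R) :
  strategy sigma ->
  sym_QRE B sigma <-> exists2 g, link_function g &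
    {in `[0, 1], forall x, sigma x = g (x - B * integral01 sigma)}.
Proof.
move=> ss; have payoffB x :
    (payoff B sigma x).1 - (payoff B sigma x).2 = x - B * integral01 sigma.
  by rewrite -payoff_diffE.
split=> [[_ [Q [/quantal_response_link[lQ QE] sQ]]]|[g lg sg]].
  by exists (fun t => Q (t, 0)) => // x /sQ ->; rewrite QE payoffB.
split=> //; exists (fun v => g (v.1 - v.2)).
by split=> [|x /sg ->]; [exact: link_quantal_response|rewrite payoffB].
Qed.

(** * Bounds on the integral of a link function *)

Lemma primitive_exists {R : realType} {g : R -> R} (L : R) : continuous g ->
  exists P : R -> R, forall t : R, -L < t < L -> is_derive t 1 P (g t).
Proof.
move=> cg.
exists (fun x => \int[lebesgue_measure]_(t in [set` `[-L, x]]) g t) => t /andP[Lt tL].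
have [|//||dP P't] := @continuous_FTC1_closed _ g (-L) t L tL.
- apply: continuous_compact_integrable; first exact: segment_compact.
  exact: continuous_subspaceT.
- exact: cg.
by rewrite -P't derive1E; exact: derivableP.
Qed.

(** Since [c] is an interior point, strict monotonicity of [g] will give strict bounds on its
    integral. *)
Lemma primitive_mean_value {R : realType} {g P : R -> R} {L : R} :
  (forall t : R, -L < t < L -> is_derive t 1 P (g t)) ->
  forall a b, a < b -> -L < a -> b < L ->
  exists2 c, a < c < b & P b - P a = g c * (b - a).
Proof.
move=> dP a b ab La bL.
have [c cab PE] : exists2 c : R, c \in `]a, b[ & P b - P a = g c * (b - a).
  apply: MVT => // [x|].
    rewrite in_itv/= => /andP[ax xb]; apply: dP.
    by rewrite (lt_trans La)// (lt_trans xb).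
  apply: derivable_within_continuous => x; rewrite in_itv/= => /andP[ax xb].
  have Lx : - L < x < L by rewrite (lt_le_trans La)// (le_lt_trans xb).
  by have [] := dP x Lx.
by exists c => //; rewrite in_itv/= in cab.
Qed.

(** The integral is that of [g] over [[- a, 1 - a]]. For [0 < a], the part over [[- a, a]] is
    exactly [a]; what must be added or removed lies between [a] and [1 - a]. For [0 < a < 1] this is
    on the positive side, where [1 / 2 < g < 1]. For [a <= 0] or [1 <= a] the whole interval lies on
    one side of [0]. *)
Lemma link_integral {R : realType} {g : R -> R} (lg : link_function g) (a : R) :
  let I := integral01 (fun x => g (x - a)) in
  [/\ a <= 0 -> 1 / 2 < I, 1 <= a -> I < 1 / 2,
      0 < a < 1 / 2 -> 1 / 2 < I, a = 1 / 2 -> I = 1 / 2 &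
      1 / 2 < a < 1 -> 1 - a < I < 1 / 2].
Proof.
(* Large enough for [- a], [a], [1 - a] and all [x - a] with [x] in [[0, 1]] to lie strictly between
   [- L] and [L]. *)
pose L := `|a| + 2.
have [aL Na] : a <= `|a| /\ - a <= `|a| by rewrite !ler_norm -normrN ler_norm.
have [P dP] := primitive_exists L (link_continuous lg).
have mvP := primitive_mean_value dP.
have -> : integral01 (fun x => g (x - a)) = P (1 - a) - P (0 - a).
  apply: (@integral01_FTC _ _ (fun x => P (x - a))).
  - exact: link_continuous_shift.
  - by move=> x; have /andP[/ltW -> /ltW ->] := link_itv lg (x - a).
  - by move=> x x01; apply: (is_derive_translate (- a)); apply: dP; rewrite /L; lra.
(* The function [P t - P (- t)] vanishes at [0] and has derivative [g t + g (- t) = 1]. *)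
have PN : 0 < a -> P a - P (- a) = a.
  move=> a0.
  have dPB (t : R) : -L < t < L -> is_derive t 1 (fun t => P t - P (0 - t)) 1.
    move=> tL; rewrite -[1 in X in is_derive _ _ _ X](addrNK (g t)) -(linkN lg).
    have dPt := dP t tL.
    have dPNt : is_derive t 1 (fun t => P (0 - t)) (- g (- t)).
      by apply: (is_derive_reflect 0); rewrite sub0r; apply: dP; lra.
    by rewrite addrC -[g (- t)]opprK; apply: is_deriveB.
  have [||c _] := primitive_mean_value dPB 0 a a0; try (rewrite /L; lra).
  by rewrite /= !subr0 sub0r subrr subr0 mul1r.
rewrite /= sub0r.
have g0 := link0 lg; have gmono := link_mono lg.
split=> [a0|a1|/andP[a0 a2]|aE|/andP[a2 a1]].
- have [|||c /andP[ac _] PE] := mvP (- a) (1 - a); try (rewrite /L; lra).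
  have : g 0 < g c by rewrite gmono; lra.
  lra.
- have [|||c /andP[_ ca] PE] := mvP (- a) (1 - a); try (rewrite /L; lra).
  have : g c < g 0 by rewrite gmono; lra.
  lra.
- have := PN a0.
  have [|||c /andP[ac _] PE] := mvP a (1 - a); try (rewrite /L; lra).
  have : g 0 < g c by rewrite gmono; lra.
  nra.
- have a0 : 0 < a by lra.
  have := PN a0; have -> : 1 - a = a by lra.
  lra.
- have a0 : 0 < a by lra.
  have := PN a0.
  have [|||c /andP[ac _] PE] := mvP (1 - a) a; try (rewrite /L; lra).
  have : g 0 < g c by rewrite gmono; lra.
  have /andP[_ gc1] := link_itv lg c.
  by move=> gc gN; apply/andP; split; nra.
Qed.

(** Four of the five cases of [link_integral] contradict [a = B * I], because [1 / 2 < B / 2 < 1].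
    In the case [1 / 2 < a < 1], the bounds on [I] become [B * (1 - a) < a < B / 2]. *)
Lemma indifferent_itv {R : realType} {B : R} {g : R -> R} {a : R} :
  1 < B -> B < 2 -> link_function g ->
  a = B * integral01 (fun x => g (x - a)) -> B / (B + 1) < a < B / 2.
Proof.
move=> B1 B2 lg; set I := integral01 _ => aE.
have [I0 I1 Il Ih Iu] := link_integral lg a.
have [/[dup] ? /I0|a0] := leP a 0; first by rewrite -/I; nra.
have [/[dup] ? /I1|a1] := leP 1 a; first by rewrite -/I; nra.
have [a2|a2|a2] := ltgtP a (1 / 2).
- by have := Il; rewrite a0 a2 -/I => /(_ isT); nra.
- have := Iu; rewrite a1 a2 -/I => /(_ isT)/andP[aI I2].
  by rewrite ltr_pdivrMr ?ltr_pdivlMr//; [apply/andP; split; nra|lra].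
- by have := Ih a2; rewrite -/I; nra.
Qed.

(** * A family of link functions with explicit integrals *)

Section sqrt_link.
Context {R : realType} {s : R} (s0 : 0 < s).

Let r (t : R) : R := Num.sqrt (t ^+ 2 + s).

Let rad_gt0 (t : R) : 0 < t ^+ 2 + s. Proof. by rewrite ltr_wpDl ?sqr_ge0. Qed.

Let r_gt0 (t : R) : 0 < r t. Proof. by rewrite sqrtr_gt0. Qed.

Let r_sqr (t : R) : r t ^+ 2 = t ^+ 2 + s. Proof. by rewrite sqr_sqrtr// ltW. Qed.

Let ltr_r (t : R) : t < r t.
Proof.
have := s0; have := r_sqr t; have := r_gt0 t; move: (r t) => u u0 uE s1.
by rewrite ltNge; apply/negP => ut; nra.
Qed.

Let rN (t : R) : r (- t) = r t. Proof. by rewrite /r sqrrN. Qed.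

Let is_derive_r (t : R) : is_derive t 1 r (t / r t).
Proof.
have dsqr : is_derive t 1 ((id : R -> R) ^+ 2 + cst s) (2 * t).
  by apply: is_derive_eq; rewrite addr0 expr1 [_ *: 1]mulr1.
have -> : t / r t = (2 * Num.sqrt (t ^+ 2 + s))^-1 * (2 * t).
  by rewrite -/(r t); have := lt0r_neq0 (r_gt0 t) => ?; field.
apply: (@is_derive1_comp _ Num.sqrt ((id : R -> R) ^+ 2 + cst s)).
exact: is_derive1_sqrt (rad_gt0 t).
Qed.

(** As [r] has derivative [t / r t], a primitive is [(t + r t) / 2], so integrals are available in
    closed form. *)
Definition sqrt_link (t : R) : R := 1 / 2 + t / (2 * r t).

Lemma is_derive_sqrt_link (t : R) : is_derive t 1 sqrt_link (s / (2 * r t ^+ 3)).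
Proof.
have rN0 := lt0r_neq0 (r_gt0 t).
have rN0' : (2 \*: r) t != 0 by rewrite /= mulf_neq0// pnatr_eq0.
have dr := is_derive_r t.
have dV := is_deriveV rN0' (is_deriveZ 2 dr).
apply: (is_derive_eq (is_deriveD (is_derive_cst (1 / 2 : R) t 1)
  (is_deriveM (is_derive_id t 1) dV))).
rewrite /GRing.scale/= -[2 *: r t]/(2 * r t).
(* The product rule gives [(r t ^+ 2 - t ^+ 2) / (2 * r t ^+ 3)]. *)
have -> : s = r t ^+ 2 - t ^+ 2 by rewrite r_sqr; ring.
by field.
Qed.

Lemma link_function_sqrt : link_function sqrt_link.
Proof.
split=> t.
- have r2 : 0 < 2 * r t by rewrite mulr_gt0.
  have := ltr_r t; have := ltr_r (- t); rewrite rN => tl tu.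
  have : -1 / 2 < t / (2 * r t) by rewrite ltr_pdivlMr//; lra.
  have : t / (2 * r t) < 1 / 2 by rewrite ltr_pdivrMr//; lra.
  by rewrite /sqrt_link; lra.
- exists (s / (2 * r t ^+ 3)); last exact: is_derive_sqrt_link.
  by rewrite divr_gt0// mulr_gt0// exprn_gt0.
- by rewrite /sqrt_link rN; field; rewrite lt0r_neq0.
Qed.

Lemma integral01_sqrt_link (a : R) :
  integral01 (fun x => sqrt_link (x - a)) =
  1 / 2 + (Num.sqrt ((1 - a) ^+ 2 + s) - Num.sqrt (a ^+ 2 + s)) / 2.
Proof.
pose F (t : R) : R := t / 2 + r t / 2.
have -> : integral01 (fun x => sqrt_link (x - a)) = F (1 - a) - F (0 - a).
  apply: (@integral01_FTC _ _ (fun x => F (x - a))).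
  - exact: (link_continuous_shift link_function_sqrt).
  - by move=> x; have /andP[/ltW -> /ltW ->] := link_itv link_function_sqrt (x - a).
  - move=> x _; apply: (is_derive_translate (- a)).
    have dr := is_derive_r (x - a).
    have -> : F = 2^-1 \*: (id : R -> R) + 2^-1 \*: r.
      by apply/funext => t; rewrite fctE /GRing.scale/= /F mulrC [r t / 2]mulrC.
    apply: is_derive_eq; rewrite /GRing.scale/= /sqrt_link.
    by field; exact: lt0r_neq0.
by rewrite /F /r sub0r sqrrN; field.
Qed.

End sqrt_link.

Lemma link_with_indifferent {R : realType} {B x : R} :
  1 < B -> B < 2 -> B / (B + 1) < x < B / 2 ->
  exists2 g, link_function g & x = B * integral01 (fun y => g (y - x)).
Proof.
(* By [integral01_sqrt_link], the equation for [s] says that the roots of [x ^+ 2 + s] and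
   [(1 - x) ^+ 2 + s] differ by [d]. Their squares differ by [2 * x - 1], so their sum must be [k].
   The two bounds on [x] amount to [0 < d < 2 * x - 1]. *)
move=> B1 B2 /andP[]; rewrite ltr_pdivrMr ?ltr_pdivlMr//; last lra.
move=> xl xu; pose d := 1 - 2 * x / B.
have dB : d * B = B - 2 * x by rewrite /d; field; lra.
have d0 : 0 < d by nra.
have dx : d < 2 * x - 1 by nra.
pose k := (2 * x - 1) / d.
have kd : k * d = 2 * x - 1 by rewrite /k divfK// lt0r_neq0.
have k1 : 1 < k by rewrite /k ltr_pdivlMr// mul1r.
(* [s] is chosen so that [x ^+ 2 + s] and [(1 - x) ^+ 2 + s] have the square
   roots [u] and [v], where [u - v = d] and [u + v = k]. *)
pose u := (k + d) / 2; pose v := (k - d) / 2; pose s := u ^+ 2 - x ^+ 2.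
have d1 : d < 1 by nra.
(* Here [2 * (u - x) = (k - 1) * (1 - d)], since [2 * x = 1 + k * d]. *)
have xu' : x < u by rewrite /u; nra.
have s0 : 0 < s by rewrite /s; nra.
exists (@sqrt_link _ s); first exact: link_function_sqrt.
rewrite integral01_sqrt_link//.
have -> : (1 - x) ^+ 2 + s = v ^+ 2.
  have -> : 1 - x = x - k * d by rewrite kd; ring.
  have xE : x = (1 + k * d) / 2 by rewrite kd; field.
  by rewrite /s /u /v xE; field.
have -> : x ^+ 2 + s = u ^+ 2 by rewrite /s; ring.
rewrite !sqrtr_sqr !gtr0_norm ?(lt_trans _ xu')//; try by rewrite /v; lra.
  by rewrite /u /v; nra.
Qed.

(** * Extension of a strategy to a link function *)

Lemma cvg_withinI {T : Type} {U : topologicalType} {F : set_system T}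
    {FF : Filter F} (A : set T) (f : T -> U) (l : U) :
  (\forall x \near F, A x) -> f @ within A F --> l -> f @ F --> l.
Proof.
by move=> FA fl V /fl; apply: filterS2 FA => x Ax; apply.
Qed.

Lemma cvg_within_setC {T : Type} {U : topologicalType} {F : set_system T}
    {FF : Filter F} (A : set T) (f : T -> U) (l : U) :
  f @ within A F --> l -> f @ within (~` A) F --> l -> f @ F --> l.
Proof.
move=> fl fCl V Vl.
have FA : \forall x \near F, A x -> V (f x) := fl V Vl.
have FCA : \forall x \near F, ~ A x -> V (f x) := fCl V Vl.
apply: filterS2 FA FCA => x fx fCx.
by have [Ax|nAx] := pselect (A x); [exact: fx|exact: fCx].
Qed.

Section link_extension.
Context {R : realType} {sigma : R -> R} {a : R}.
Hypothesis a_itv : 1 / 2 < a < 1.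
Hypothesis dsigma : pos_derivable01 sigma.
Hypothesis sigma_itv : {in `[0, 1], forall x : R, 0 < sigma x < 1}.
Hypothesis sigma_a : sigma a = 1 / 2.
Hypothesis sigma_sym : {in `[0, 1 - a], forall delta : R,
  sigma (a + delta) = 1 - sigma (a - delta)}.

Let p : R := sigma 0.
Variable c : R.
Hypothesis c0 : 0 < c.
Hypothesis dsigma0 :
  (sigma y - sigma 0) / (y - 0) @[y --> within `[0, 1] (0 : R)^'] --> c.

(* To the left of [0], [sigma] is continued by a hyperbola with the same value
   and slope at [0]. *)
Let left_tail (x : R) : R := p ^+ 2 / (p - c * x).
Let left_half (x : R) : R := if x < 0 then left_tail x else sigma x.
(** The point reflection about [(a, 1 / 2)] makes the symmetry hold by construction; agreement with
    [sigma] on [[a, 1]] is then [sigma_sym]. *)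
Let ext (x : R) : R :=
  if x <= a then left_half x else 1 - left_half (2 * a - x).

Let p_itv : 0 < p < 1.
Proof. by apply: sigma_itv; rewrite in_itv/= lexx ler01. Qed.

Let left_half_itv x : x <= a -> 0 < left_half x < 1.
Proof.
move=> xa; rewrite /left_half; have [x0|x0] := ltP x 0; last first.
  apply: sigma_itv; rewrite in_itv/= x0/=.
  by have /andP[_ /ltW] := a_itv; apply: le_trans.
have := p_itv; rewrite /left_tail; move: p => q /andP[q0 q1].
have cx : c * x < 0 by rewrite pmulr_rlt0.
have qcx : 0 < q - c * x by lra.
by rewrite divr_gt0 ?exprn_gt0//= ltr_pdivrMr//; nra.
Qed.

Let ext_itv x : 0 < ext x < 1.
Proof.
rewrite /ext; have [xa|ax] := leP x a; first exact: left_half_itv.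
by have := @left_half_itv (2 * a - x); lra.
Qed.

Let extN x : ext (2 * a - x) = 1 - ext x.
Proof.
rewrite /ext; have [xa|ax|->] := ltgtP x a.
- by rewrite ifF; [congr (1 - left_half _); ring|apply/negbTE; rewrite -ltNge; lra].
- by rewrite ifT; [ring|lra].
(* At the centre of the reflection the identity amounts to [sigma a = 1 / 2]. *)
- rewrite ifT; last lra.
  have -> : 2 * a - a = a by ring.
  rewrite /left_half ifF ?sigma_a; first by field.
  by apply/negbTE; have := a_itv; rewrite -leNgt; lra.
Qed.

Let extE x : 0 <= x <= 1 -> ext x = sigma x.
Proof.
have ha := a_itv => x01; rewrite /ext; have [xa|ax] := leP x a.
  by rewrite /left_half ifF//; apply/negbTE; rewrite -leNgt; lra.
rewrite /left_half ifF; last by apply/negbTE; rewrite -leNgt; lra.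
have := @sigma_sym (x - a); rewrite in_itv/= => /(_ _)/esym.
have -> : a - (x - a) = 2 * a - x by ring.
by rewrite addrCA subrr addr0; apply; lra.
Qed.

Let ext_left x : x < 0 -> ext x = left_tail x.
Proof.
by move=> x0; rewrite /ext /left_half x0 ifT//; have := a_itv; lra.
Qed.

Let is_derive_left_tail (x : R) : x <= 0 ->
  is_derive x 1 left_tail (c * p ^+ 2 / (p - c * x) ^+ 2).
Proof.
move=> x0; have /andP[p0 _] := p_itv.
have qN0 : p - c * x != 0.
  by rewrite lt0r_neq0// subr_gt0 (le_lt_trans _ p0)// pmulr_rle0.
have pcx : (cst p - c \*: (id : R -> R)) x != 0 := qN0.
have dV := is_deriveV pcx
  (is_deriveB (is_derive_cst p x 1) (is_deriveZ c (is_derive_id x 1))).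
apply: (is_derive_eq (is_deriveM (is_derive_cst (p ^+ 2) x 1) dV)).
rewrite /GRing.scale/= -[(cst p - c \*: (id : R -> R)) x]/(p - c * x).
by rewrite /cst; field.
Qed.

(** Points below [1] suffice: for [1 <= x] the reflected point satisfies
    [2 * a - x <= 2 * a - 1 < 1]. At [a] there is nothing to glue, because [ext] agrees with [sigma]
    on all of [[0, 1]]; the only seam is at [0]. *)
Let is_derive_ext_lt1 (x : R) : x < 1 ->
  exists2 k, 0 < k & is_derive x 1 ext k.
Proof.
move=> x1; have /andP[p0 _] := p_itv.
have [x0|x0|->] := ltgtP x 0.
- have cx : c * x < 0 by rewrite pmulr_rlt0.
  exists (c * p ^+ 2 / (p - c * x) ^+ 2).
    by rewrite divr_gt0 ?mulr_gt0 ?exprn_gt0//; rewrite subr_gt0 (lt_trans cx).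
  apply/is_derive_quotient.
  have /is_derive_quotient := is_derive_left_tail x (ltW x0).
  apply: cvg_trans; apply: near_eq_cvg; apply: cvg_within.
  near=> y; rewrite !ext_left//; near: y.
  exact: lt_nbhsl.
- have x01 : x \in `[0, 1] by rewrite in_itv/= !ltW.
  have [k k0 dk] := dsigma x x01.
  exists k => //; apply/is_derive_quotient.
  apply: (@cvg_withinI _ _ _ _ `[0, 1]).
    apply: cvg_within; near=> y; rewrite /= in_itv/=; apply/andP; split.
      by near: y; exact: lt_le_nbhsr.
    by near: y; exact: lt_le_nbhsl.
  apply: cvg_trans dk; apply: near_eq_cvg; rewrite near_withinE; apply: nearW => y /=.
  by rewrite !in_itv/= => y01; rewrite !extE// !ltW.
(* At the seam, the quotients within [[0, 1]] tend to [c] by [dsigma0], and those outside tend to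
   the slope [c * p ^+ 2 / p ^+ 2] of the hyperbola. *)
- exists c => //; apply/is_derive_quotient.
  apply: (@cvg_within_setC _ _ _ _ `[0, 1]).
    apply: cvg_trans dsigma0; apply: near_eq_cvg.
    rewrite near_withinE; apply: nearW => y /=.
    by rewrite !in_itv/= => y01; rewrite !extE// lexx ler01.
  have /is_derive_quotient := is_derive_left_tail 0 (lexx _).
  rewrite mulr0 subr0 mulfK ?expf_neq0 ?lt0r_neq0// => dl.
  apply: cvg_trans (cvg_trans (cvg_app _ (cvg_within _)) dl).
  apply: near_eq_cvg.
  (* The complement of [[0, 1]] also contains points above [1], which are excluded near [0]. *)
  have y1 : \forall y \near (0 : R)^', y < 1.
    by apply: cvg_within; apply: lt_nbhsl.
  apply: filterS y1 => y y1 /=; rewrite in_itv/= => /negP.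
  rewrite negb_and -!ltNge => /orP[y0|]; last lra.
  rewrite ext_left// extE ?lexx ?ler01//.
  by rewrite /left_tail mulr0 subr0 -/p expr2 mulfK// lt0r_neq0.
Unshelve. all: by end_near. Qed.

Lemma link_extension_slope :
  exists2 g, link_function g & {in `[0, 1], forall x, sigma x = g (x - a)}.
Proof.
exists (fun t => ext (t + a)) => [|x]; last first.
  by rewrite in_itv/= subrK => /extE ->.
split=> t; first exact: ext_itv.
- suff [k k0 dk] : exists2 k, 0 < k & is_derive (t + a) 1 ext k.
    by exists k => //; exact: is_derive_translate.
  have [/is_derive_ext_lt1//|ta] := ltP (t + a) 1.
  have [|k k0 dk] := @is_derive_ext_lt1 (2 * a - (t + a)).
    by have := a_itv; lra.
  exists k => //; rewrite -[k]opprK -sub0r.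
  have -> : ext = cst 1 - (fun x => ext (2 * a - x)).
    by apply/funext => x; rewrite -[RHS]/(1 - ext (2 * a - x)) extN; ring.
  by apply: is_deriveB; exact: is_derive_reflect.
- by rewrite /= -extN; congr (ext _); ring.
Qed.

End link_extension.

Lemma link_extension {R : realType} {sigma : R -> R} {a : R} :
  1 / 2 < a < 1 -> pos_derivable01 sigma ->
  {in `[0, 1], forall x : R, 0 < sigma x < 1} -> sigma a = 1 / 2 ->
  {in `[0, 1 - a], forall delta : R,
    sigma (a + delta) = 1 - sigma (a - delta)} ->
  exists2 g, link_function g & {in `[0, 1], forall x, sigma x = g (x - a)}.
Proof.
move=> ha dsigma s01 sa ssym.
have [|c c0 dc] := dsigma 0; first by rewrite in_itv/= lexx ler01.
exact: link_extension_slope dc.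
Qed.

(** * Properties of a strategy given by a link function *)

Section link_strategy.
Context {R : realType} {sigma g : R -> R} {a : R} (lg : link_function g).
Hypothesis sigmaE : {in `[0, 1], forall x, sigma x = g (x - a)}.

Lemma link_strategy_continuous : {within `[0, 1], continuous sigma}.
Proof.
apply: (@subspace_eq_continuous _ _ _ (fun x => g (x - a))).
  by move=> x /set_mem x01; rewrite /from_subspace sigmaE.
by apply: continuous_subspaceT; exact: link_continuous_shift.
Qed.

Lemma link_strategy_homo : {in `[0, 1] &, {homo sigma : x y / x < y}}.
Proof.
by move=> x y x01 y01 xy; rewrite !sigmaE// (link_mono lg) ltrD2r.
Qed.

Lemma link_strategy_pos_derivable : pos_derivable01 sigma.
Proof.
move=> x x01; have [c c0 /is_derive_translate dg] := link_derive lg (x - a).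
exists c => //; have /is_derive_quotient gq := dg.
apply: cvg_trans (cvg_trans (cvg_app _ (cvg_within _)) gq).
apply: near_eq_cvg; rewrite near_withinE; apply: nearW => y y01.
by rewrite !sigmaE.
Qed.

Lemma link_strategy_itv : {in `[0, 1], forall x, 0 < sigma x < 1}.
Proof. by move=> x x01; rewrite sigmaE//; exact: link_itv. Qed.

(** By [linkN] and the injectivity of [g]. This serves both for [symmetric_strategy] and for the
    reflection identity in (iv). *)
Lemma link_strategy_sym x y : x \in `[0, 1] -> y \in `[0, 1] ->
  sigma x = 1 - sigma y <-> x - a = - (y - a).
Proof.
move=> x01 y01; rewrite !sigmaE// -(linkN lg); split=> [|->//].
exact: (inc_inj (le_mono (link_homo lg))).
Qed.

End link_strategy.

(** * The characterization of sym-QRE *)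

Theorem proposition3 (R : realType) (B : R) (hB1 : 1 < B) (hB2 : B < 2) :
  indifferent_types B = [set x : R | B / (B + 1) < x < B / 2] /\
  forall sigma : R -> R, strategy sigma ->
    (sym_QRE B sigma <->
      {within `[0, 1], continuous sigma} /\
      {in `[0, 1] &, {homo sigma : x y / x < y}} /\
      pos_derivable01 sigma /\
      {in `[0, 1], forall x : R, 0 < sigma x < 1} /\
      exists xt : R,
        unique (fun z => [/\ B / (B + 1) < z < B / 2,
                             sigma z = 1 / 2 &
                             z = B * integral01 sigma]) xt /\
        symmetric_strategy B sigma /\
        {in `[0, 1 - xt], forall delta : R,
          sigma (xt + delta) = 1 - sigma (xt - delta)}).
Proof.
(* Together with [B / 2 < 1], this places every candidate indifferent type strictly between [1 / 2]
   and [1]. *)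
have half_lt_lb : 1 / 2 < B / (B + 1) by rewrite ltr_pdivlMr; lra.
have indiff_itv sigma g : link_function g ->
    {in `[0, 1], forall x, sigma x = g (x - B * integral01 sigma)} ->
    B / (B + 1) < B * integral01 sigma < B / 2.
  move=> lg sE; apply: (indifferent_itv hB1 hB2 lg); congr (B * _).
  exact: eq_integral01.
split.
  apply/seteqP; split=> x /= => [[_ [sigma [sQ]]]|xB].
    have ss : strategy sigma by case: sQ.
    rewrite (payoff_diffE _ _ ss) => /eqP; rewrite subr_eq0 => /eqP ->.
    have /(sym_QRE_link _ _ ss)[g lg sE] := sQ.
    exact: indiff_itv lg sE.
  split; first by rewrite in_itv/=; lra.
  have [g lg xE] := link_with_indifferent hB1 hB2 xB.
  have ss : strategy (fun y => g (y - x)).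
    apply: continuous_strategy; first exact: link_continuous_shift.
    by move=> y; have /andP[/ltW -> /ltW ->] := link_itv lg (y - x).
  exists (fun y => g (y - x)); split; last by rewrite payoff_diffE// -xE subrr.
  by apply/(sym_QRE_link _ _ ss); exists g => // y _; rewrite -xE.
move=> sigma ss; split=> [/(sym_QRE_link _ _ ss)[g lg sE]|].
  set a := B * integral01 sigma in sE *.
  have aB : B / (B + 1) < a < B / 2 by exact: indiff_itv lg sE.
  have a01 : a \in `[0, 1] by rewrite in_itv/=; lra.
  split; first exact: link_strategy_continuous lg sE.
  split; first exact: link_strategy_homo lg sE.
  split; first exact: link_strategy_pos_derivable lg sE.
  split; first exact: link_strategy_itv lg sE.
  exists a; split.
    split; last by move=> z [_ _ ->].
    by split=> //; rewrite sE// subrr link0.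
  split=> [x y x01 y01|delta].
    by rewrite !payoff_diffE//; exact: (link_strategy_sym lg sE).
  rewrite in_itv/= => /andP[d0 d1].
  (* The point [a - delta] is at least [2 * a - 1], hence in [[0, 1]]. *)
  apply/(link_strategy_sym lg sE); rewrite ?in_itv/=; [lra|lra|ring].
move=> [_ [_ [dsigma [s01 [a [[[aB sa aE] _] [_ ssym]]]]]]].
(* The equation [aE] identifies the centre of the extension with the threshold
   [B * integral01 sigma] of a sym-QRE. *)
apply/(sym_QRE_link _ _ ss); rewrite -aE.
by apply: link_extension => //; lra.
Qed.
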